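(* Let $T$ be a finite tree, let $k$ be a positive integer with $k\le |T|$, and let $S\subseteq T$ be a $k$-maximal subtree of $T$. If there exists a leaf $w$ of $S$ with $\deg_T(w)>2$, then every other leaf $v\neq w$ of $S$ satisfies $\deg_T(v)=1$.
   Context: A subtree of a tree $T$ is a nonempty connected subgraph; $|T|$ denotes the number of vertices of $T$. For a subtree $S\subseteq T$, let $N_T(S)$ be the number of subtrees of $T$ containing $S$ and $R_T(S)$ the sum of the orders (numbers of vertices) of all subtrees of $T$ containing $S$. The local mean at $S$ is $\mu_T(S)=R_T(S)/N_T(S)$. A $k$-maximal subtree of $T$ is a subtree of order $k$ whose local mean is maximal among all subtrees of $T$ of order $k$. A leaf of $S$ is a vertex of degree $1$ in $S$. $\deg_T(v)$ is the degree of $v$ in $T$. *)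

(* Defs.v *)
From mathcomp Require Import all_boot all_order all_algebra.

Set Implicit Arguments.
Unset Strict Implicit.
Unset Printing Implicit Defensive.

Import Order.TTheory GRing.Theory Num.Theory.

(* A graph on vertices drawn from U is a pair (vertex set, edge set), an edge
   being the 2-element set of its ends. The vertex set need not be all of U, so
   a graph and its subgraphs have the same type. *)
Definition graph (U : finType) : predArgType :=
  ({set U} * {set {set U}})%type.

Section Graphs.

Variable U : finType.
Implicit Types (G H S T : graph U) (x y v : U) (k : nat).

Definition vertices G : {set U} := G.1.
Definition edges G : {set {set U}} := G.2.

Definition simple_graph G : bool :=
  [forall a in edges G, (#|a| == 2) && (a \subset vertices G)].

Definition graph_order G : nat := #|vertices G|.

(* [set x; x] is a singleton, so adj G is irreflexive if G is a simple graph. *)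
Definition adj G : rel U := fun x y => [set x; y] \in edges G.

Definition deg G v : nat := #|[set a in edges G | v \in a]|.

Definition leaf G v : bool := (v \in vertices G) && (deg G v == 1).

Definition connected G : bool :=
  [forall x in vertices G, forall y in vertices G, connect (adj G) x y].

(* ucycle also accepts the closed walk x, y, x along one edge, whence the bound
   2 rather than 0. *)
Definition acyclic G : Prop :=
  forall c : seq U, ucycle (adj G) c -> size c <= 2.

Definition tree G : Prop :=
  [/\ simple_graph G, vertices G != set0, connected G & acyclic G].

Definition subgraph H G : bool :=
  [&& simple_graph H, vertices H \subset vertices G & edges H \subset edges G].

Definition subtree S T : bool :=
  [&& subgraph S T, vertices S != set0 & connected S].

Definition subtrees_containing T S : {set graph U} :=
  [set H : graph U | subtree H T && subgraph S H].

Definition num_subtrees T S : nat := #|subtrees_containing T S|.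

Definition sum_of_orders T S : nat :=
  \sum_(H in subtrees_containing T S) graph_order H.

Definition local_mean T S : rat :=
  ((sum_of_orders T S)%:R / (num_subtrees T S)%:R)%R.

Definition maximal_subtree T k S : Prop :=
  [/\ subtree S T, graph_order S = k &
      forall S' : graph U, subtree S' T -> graph_order S' = k ->
        (local_mean T S' <= local_mean T S)%R].

End Graphs.

(* Main.v *)
Require Import Defs.
From mathcomp Require Import all_boot all_order all_algebra.
From mathcomp Require Import zify ring lra.

(** Identify subtrees of [T] with connected vertex sets.  For an edge [p c], the
branch at [c] is what hangs on [p] through [c]; let [N] and [R] be the number
and the total order of the connected sets of the branch that contain [c].  A
connected set that contains [p] and [c] is a connected set that contains [p]
and misses [c], together with one of these [N] sets ([sum_fam_glue]).  Hence
adjoining [c] to any connected set [P] that contains [p] and not [c] raises the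
local mean by the same amount, the gain [R / (N (N + 1))], whatever [P] is
([mean_attach]).

Let [v] and [w] be distinct leaves of [S], with neighbours [p] and [q] in [S].
Exchanging [v] for a neighbour [x] of [w] outside [S], or [w] for a neighbour
[y] of [v] outside [S], gives a subtree of the same order, so maximality says
  gain w x <= gain p v   and   gain v y <= gain q w
([maximal_exchange]).  Call [x] and [y] the children of [w] and [v].  The same
decomposition expresses the gain of a vertex by its children: if these have
gains [g_i] and counts [n_i], the gain is
  (1 + sum g_i n_i) / (1 + prod (1 + n_i)).
When there are at least two children and every [g_i] is at most [c], this is
less than [c], and at most [(3 - 2 c) c^2 / (1 + c^2)] if [c <= 1/2]
([many_children]); the point is that [c (1 + n_i) >= 1] since the subtrees
counted have order at least [1].

Suppose that [w] has two children and [v] has at least one.  Then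
gain q w < gain p v.  If [v] had two children too, the same argument would give
the reverse inequality.  If [y] is the only child of [v], then gain p v is the
average of 1/2 and gain v y with weights [2] and [n], where [n] is the count at
[y].  This average exceeds gain v y too little for gain v y to stay below the
bound [(3 - 2 c) c^2 / (1 + c^2)] with [c] = gain p v ([single_child_absurd]). *)

Set Implicit Arguments.
Unset Strict Implicit.
Unset Printing Implicit Defensive.

Import Order.TTheory GRing.Theory Num.Theory.

(** * Inequalities for the gain at a vertex *)

Section Estimates.

Variable F : realFieldType.
Implicit Types c g m n N R : F.
Local Open Scope ring_scope.

(** Here [m] and [N] are the local mean and the count at a vertex with two
children of gains [g1], [g2] and counts [n1], [n2], so that the gain of the
vertex is [m / (1 + N)].  With [p = c (1 + n1) - 1] and [q = c (1 + n2) - 1],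
both nonnegative, the last bound is a sum of nonnegative terms in [p] and [q],
with equality at [p = q = 0] when the gains equal [c]. *)
Lemma two_children_estimate c g1 g2 n1 n2 :
  0 <= c -> 1 <= n1 -> 1 <= n2 -> 1 <= c * (1 + n1) -> 1 <= c * (1 + n2) ->
  g1 <= c -> g2 <= c ->
  let m := 1 + g2 * n2 + g1 * n1 in let N := (1 + n2) * (1 + n1) in
  [/\ 1 <= c ^+ 2 * N, m < c * (1 + N) &
      c <= 1 / 2 -> (1 + c ^+ 2) * m <= (3 - 2 * c) * c ^+ 2 * (1 + N)].
Proof.
move=> c0 n1p n2p cn1 cn2 gc1 gc2 m N.
have mle : m <= 1 + c * n2 + c * n1 by rewrite /m; nra.
have cN : 1 <= c ^+ 2 * N.
  have -> : c ^+ 2 * N = (c * (1 + n2)) * (c * (1 + n1)) by rewrite /N; ring.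
  by nra.
split=> // [|c2].
  apply: le_lt_trans mle _; rewrite /N.
  have : 0 <= c * ((n1 - 1) * n2) by rewrite mulr_ge0 // mulr_ge0 //; lra.
  by nra.
have : (1 + c ^+ 2) * m <= (1 + c ^+ 2) * (1 + c * n2 + c * n1).
  by rewrite ler_wpM2l //; nra.
move/le_trans; apply; rewrite -subr_ge0.
set p := c * (1 + n1) - 1; set q := c * (1 + n2) - 1.
have -> : (3 - 2 * c) * c ^+ 2 * (1 + N) - (1 + c ^+ 2) * (1 + c * n2 + c * n1) =
  (p + q) * (2 - 2 * c - c ^+ 2) + (3 - 2 * c) * (p * q).
  by rewrite /N /p /q; ring.
have p0 : 0 <= p by rewrite /p; lra.
have q0 : 0 <= q by rewrite /q; lra.
by rewrite addr_ge0 // mulr_ge0 //; nra.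
Qed.

(** A further child adds at most [c n] to the mean but multiplies the count by
[1 + n], and [c ^+ 2 * N >= 1] makes the right-hand sides grow faster. *)
Lemma next_child_estimate c g n m N :
  0 <= c -> 1 <= n -> 1 <= N -> g <= c ->
  [/\ 1 <= c ^+ 2 * N, m < c * (1 + N) &
      c <= 1 / 2 -> (1 + c ^+ 2) * m <= (3 - 2 * c) * c ^+ 2 * (1 + N)] ->
  [/\ 1 <= c ^+ 2 * (N * (1 + n)), m + g * n < c * (1 + N * (1 + n)) &
      c <= 1 / 2 -> (1 + c ^+ 2) * (m + g * n) <=
        (3 - 2 * c) * c ^+ 2 * (1 + N * (1 + n))].
Proof.
move=> c0 np Np gc [cN mN mN2]; split=> [||c2].
- by nra.
- have : g * n <= c * n by rewrite ler_wpM2r //; lra.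
  have : 0 <= c * n * (N - 1) by rewrite !mulr_ge0 //; lra.
  by nra.
have := mN2 c2.
have : (1 + c ^+ 2) * (g * n) <= (1 + c ^+ 2) * (c * n).
  by rewrite ler_wpM2l ?ler_wpM2r //; nra.
have : (1 + c ^+ 2) * (c * n) <= (3 - 2 * c) * (c ^+ 2 * N) * n.
  rewrite mulrA ler_wpM2r //; first by lra.
  apply: (@le_trans _ _ (3 - 2 * c)); first by nra.
  by rewrite ler_peMr //; lra.
by nra.
Qed.

(** [c] is the gain of a vertex whose only child has gain [g], count [n] and
total order [r], and [h] is the gain of a vertex with several children of gain
at most [c].  Since [c] is the average of 1/2 and [g] with weights [2] and [n],
[g < c] forces [c < 1 / 2], and then [c - g = (1 - 2 c) / n].  The bound
[2 n - 1 <= r] makes [c] at least 1/2 when [n <= 2], and [c n] at least 27/20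
when [n >= 3]; in the latter case [c - g] is smaller than the gap between [c]
and the bound on [h]. *)
Lemma single_child_absurd c g n r h :
  1 <= n -> 2 * n - 1 <= r -> (n <= 2) || (3 <= n) ->
  g * (n * (1 + n)) = r -> c * (2 + n) = 1 + g * n ->
  g <= h -> h < c -> (c <= 1 / 2 -> (1 + c ^+ 2) * h <= (3 - 2 * c) * c ^+ 2) ->
  False.
Proof.
move=> n1 rn ncase gr cn gh hc hle.
have c2 : c < 1 / 2 by nra.
have gn : g * n * (1 + n) = r by rewrite -gr; ring.
have cn3 : 3 * n <= c * ((2 + n) * (1 + n)).
  by rewrite mulrA cn; lra.
case/orP: ncase => n3.
  have : (2 + n) * (1 + n) <= 6 * n by nra.
  by nra.
set t := c * n.
have t27 : 27 / 20 <= t.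
  have pos : 0 < (2 + n) * (1 + n) by nra.
  have : 27 / 20 * ((2 + n) * (1 + n)) <= t * ((2 + n) * (1 + n)).
    apply: (@le_trans _ _ (3 * n * n)); first by nra.
    rewrite /t [leRHS]mulrAC ler_wpM2r //; lra.
  by rewrite ler_pM2r.
have c0 : 0 < c by rewrite /t in t27; nra.
have key : (1 + c ^+ 2) * g <= (3 - 2 * c) * c ^+ 2.
  by apply: le_trans (hle (ltW c2)); rewrite ler_wpM2l //; nra.
have {}key : t * (1 - 3 * c + 3 * c ^+ 2) <= (1 - 2 * c) * (1 + c ^+ 2).
  have gt : g * n = t + 2 * c - 1 by rewrite /t; lra.
  have : (1 + c ^+ 2) * g * n <= (3 - 2 * c) * c ^+ 2 * n by rewrite ler_wpM2r //; lra.
  rewrite -mulrA gt (_ : _ * n = (3 - 2 * c) * c * t); last by rewrite /t; ring.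
  by nra.
have pos : 0 <= 1 - 3 * c + 3 * c ^+ 2 by nra.
have : 27 / 20 * (1 - 3 * c + 3 * c ^+ 2) <= t * (1 - 3 * c + 3 * c ^+ 2).
  by rewrite ler_wpM2r.
(* With [quad], lower bounds on a cubic whose minimum on [0, 1/2] is positive but
   small, near c = 27/100. *)
have cube : 0 <= c * (c - 1 / 4) ^+ 2 by rewrite mulr_ge0 ?sqr_ge0 ?ltW.
have quad : 0 <= (c - 27 / 100) ^+ 2 by rewrite sqr_ge0.
by nra.
Qed.

End Estimates.

(** * Connected vertex sets and branches *)

Definition induced (U : finType) (e : rel U) (X : {set U}) : rel U :=
  fun x y => [&& x \in X, y \in X & e x y].
Arguments induced {U} e X x y /.

Lemma connect_homo (T1 T2 : finType) (r1 : rel T1) (r2 : rel T2) (f : T1 -> T2) :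
  (forall x y, r1 x y -> connect r2 (f x) (f y)) ->
  forall x y, connect r1 x y -> connect r2 (f x) (f y).
Proof.
move=> hom x y /connectP[p]; elim: p x => [|z p IHp] x /= => [_ -> // | ].
by case/andP=> /hom rxz pzp ylast; apply: connect_trans rxz (IHp z pzp ylast).
Qed.

Lemma disjoint_setUl (U : finType) (A B C : {set U}) :
  [disjoint A :|: B & C] = [disjoint A & C] && [disjoint B & C].
Proof. by rewrite -!setI_eq0 setIUl setU_eq0. Qed.

Lemma disjoint_setU1r (U : finType) (x : U) (A B : {set U}) :
  [disjoint A & x |: B] = (x \notin A) && [disjoint A & B].
Proof. by rewrite disjoint_sym disjoint_setUl disjoints1 disjoint_sym. Qed.

Section ConnectedSets.

Variables (U : finType) (e : rel U) (V : {set U}).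
Hypothesis e_sym : symmetric e.
Hypothesis e_irr : irreflexive e.
Hypothesis e_V : forall x y, e x y -> x \in V.
Hypothesis e_acyclic : forall c : seq U, ucycle e c -> size c <= 2.
Implicit Types (X Y P A Q : {set U}) (x y z p c v w : U).

Definition conn X : bool :=
  (X \subset V) && [forall x in X, forall y in X, connect (induced e X) x y].

Lemma induced_sym X : symmetric (induced e X).
Proof. by move=> x y /=; rewrite e_sym andbCA. Qed.

Lemma induced_connect_sym X : connect_sym (induced e X).
Proof. exact: sym_connect_sym (@induced_sym X). Qed.

Lemma connP X :
  reflect (X \subset V /\ {in X &, forall x y, connect (induced e X) x y}) (conn X).
Proof.
apply: (iffP andP) => -[XV cX]; split=> //.
  by move=> x y xX yX; move/forall_inP/(_ x xX)/forall_inP: cX; apply.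
by apply/forall_inP=> x xX; apply/forall_inP=> y yX; apply: cX.
Qed.

(** A retraction that sends each edge to an edge or to a point maps walks to
walks. *)
Lemma conn_retract X Y (f : U -> U) :
    conn X -> Y \subset X -> {in X, forall x, f x \in Y} -> {in Y, f =1 id} ->
    {in X &, forall x y, e x y -> f x = f y \/ e (f x) (f y)} ->
  conn Y.
Proof.
case/connP=> XV cX YX fXY fY fe; apply/connP; split; first exact: subset_trans YX XV.
move=> x y xY yY; rewrite -(fY x xY) -(fY y yY).
apply: connect_homo (cX x y (subsetP YX x xY) (subsetP YX y yY)) => a b.
case/and3P=> aX bX eab; case: (fe a b aX bX eab) => [-> // | efab].
by apply: connect1; rewrite /= !fXY.
Qed.

Lemma connect_induced_sub X Y x y :
  X \subset Y -> connect (induced e X) x y -> connect (induced e Y) x y.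
Proof.
move=> XY; apply: connect_sub => a b /and3P[aX bX eab].
by apply: connect1; rewrite /= eab !(subsetP XY).
Qed.

Lemma conn1 x : x \in V -> conn [set x].
Proof.
move=> xV; apply/connP; rewrite sub1set; split=> // a b.
by rewrite !inE => /eqP-> /eqP->.
Qed.

Lemma connU X Y x y : conn X -> conn Y -> x \in X -> y \in Y -> e x y -> conn (X :|: Y).
Proof.
case/connP=> XV cX /connP[YV cY] xX yY exy.
apply/connP; rewrite subUset XV; split=> //.
have to_x z : z \in X :|: Y -> connect (induced e (X :|: Y)) x z.
  case/setUP=> [zX | zY].
    exact: connect_induced_sub (subsetUl _ _) (cX _ _ xX zX).
  apply: connect_trans (connect1 _) _; last first.
    exact: connect_induced_sub (subsetUr _ _) (cY _ _ yY zY).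
  by rewrite /= !inE xX yY orbT.
move=> a b /to_x xa /to_x; apply: connect_trans.
by rewrite induced_connect_sym.
Qed.

Lemma conn_closed X Y x y :
    conn X -> {in X &, forall a b, e a b -> a \in Y -> b \in Y} ->
  x \in X -> y \in X -> x \in Y -> y \in Y.
Proof.
case/connP=> _ cX clY xX yX xY; have /connectP[s] := cX x y xX yX.
elim: s x xX xY => [|z s IHs] x xX xY /= => [_ -> // |].
case/andP=> /and3P[_ zX exz]; exact/IHs/(clY x).
Qed.

Definition nbrs v : {set U} := [set x | e v x].

(** The component of [c] after deletion of [p]; for an edge [p c] of a tree it is
one side of this edge. *)
Definition branch p c : {set U} := [set z | connect (induced e [set~ p]) c z].

Lemma branch_root p c : c \in branch p c.
Proof. by rewrite inE connect0. Qed.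

Lemma branch_notin p c : p != c -> p \notin branch p c.
Proof.
move=> npc; rewrite inE; apply/connectP=> -[s]; case/lastP: s => [_ /eqP|s z].
  exact/negP.
rewrite last_rcons rcons_path => /andP[_ /and3P[_ + _]] pz.
by rewrite -pz !inE eqxx.
Qed.

(** An edge leaving the branch can only end at [p], and if it started elsewhere
than at [c], a path of the branch from [c] would close up to a cycle through
[p]. *)
Lemma branch_cut p c b z :
  e p c -> e b z -> b \in branch p c -> z \notin branch p c -> b = c /\ z = p.
Proof.
move=> epc ebz bB zB.
have npc : p != c by apply: contraTneq epc => ->; rewrite e_irr.
have nbp : b != p by apply: contraTneq bB => ->; apply: branch_notin.
have zp : z = p.
  apply: contraNeq zB => nzp; move: bB; rewrite !inE => cb.
  by apply: connect_trans cb (connect1 _); rewrite /= !inE nbp nzp.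
split=> //; move: bB; rewrite inE => /connectP[s0 path_s0 last_s0].
case: (shortenP path_s0) last_s0 => s path_s uniq_s _ last_s.
have e_s : path e c s by apply: sub_path path_s => x y /and3P[].
have ps : p \notin c :: s.
  rewrite inE (negPf npc) /=; apply/negP => {uniq_s last_s e_s}.
  elim: s c {npc epc s0 path_s0 zB} path_s => [//|a s IHs] c /=.
  case/andP=> /and3P[_ + _] /IHs{}IHs; rewrite !inE eq_sym => /negPf->.
  exact: IHs.
have : ucycle e (p :: c :: s).
  rewrite /ucycle /cycle rcons_path /= epc e_s -last_s -zp ebz /=.
  by rewrite zp; apply/andP; split.
by move/e_acyclic; rewrite /= !ltnS leqn0 => /nilP s_nil; rewrite last_s s_nil.
Qed.

Lemma nbrs_branch p c A :
  e p c -> A \subset nbrs p -> c \notin A -> [disjoint A & branch p c].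
Proof.
move=> epc Ap cA; apply/pred0P=> z /=; apply/negP=> /andP[zA zB].
have npc : p != c by apply: contraTneq epc => ->; rewrite e_irr.
have ezp : e z p by rewrite e_sym; move/subsetP/(_ z zA): Ap; rewrite inE.
have [zc _] := branch_cut epc ezp zB (branch_notin npc).
by rewrite -zc zA in cA.
Qed.

Lemma conn_branch_sub p c Q : conn Q -> c \in Q -> p \notin Q -> Q \subset branch p c.
Proof.
case/connP=> _ cQ cinQ pQ; apply/subsetP=> z zQ; rewrite inE.
by apply: connect_induced_sub (cQ c z cinQ zQ); rewrite subsetC sub1set inE.
Qed.

Lemma conn_branch_disjoint p c Y :
  e p c -> conn Y -> p \in Y -> c \notin Y -> [disjoint Y & branch p c].
Proof.
move=> epc cY pY cNY; apply/pred0P=> z /=; apply/negP=> /andP[zY zB].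
have npc : p != c by apply: contraTneq epc => ->; rewrite e_irr.
have /negP := branch_notin npc; apply.
apply: conn_closed cY _ zY pY zB => a b aY bY eab aB.
apply: contraNT cNY => bNB.
by have [<- _] := branch_cut epc eab aB bNB.
Qed.

(** Sending everything outside the branch to its root [c] is a retraction, since
[p c] is the only edge that crosses. *)
Lemma conn_setI_branch p c X : e p c -> conn X -> c \in X -> conn (X :&: branch p c).
Proof.
move=> epc cX cinX.
apply: (conn_retract (f := fun z => if z \in branch p c then z else c) cX).
- exact: subsetIl.
- by move=> z zX; rewrite inE; case: ifP => zB; rewrite ?zX ?zB // cinX branch_root.
- by move=> z; rewrite inE => /andP[_ ->].
move=> x y xX yX exy; case: ifP => xB; case: ifP => yB; try by [left | right].
  by left; have [] := branch_cut epc exy xB (negbT yB).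
rewrite e_sym in exy.
by left; have [] := branch_cut epc exy yB (negbT xB).
Qed.

Lemma conn_setD_branch p c X : e p c -> conn X -> p \in X -> conn (X :\: branch p c).
Proof.
move=> epc cX pinX.
have npc : p != c by apply: contraTneq epc => ->; rewrite e_irr.
apply: (conn_retract (f := fun z => if z \in branch p c then p else z) cX).
- exact: subsetDl.
- move=> z zX; rewrite inE; case: ifP => zB; rewrite ?zX ?zB //.
  by rewrite pinX branch_notin.
- by move=> z; rewrite inE => /andP[/negPf->].
move=> x y xX yX exy; case: ifP => xB; case: ifP => yB; try by [left | right].
  by left; have [] := branch_cut epc exy xB (negbT yB).
rewrite e_sym in exy.
by left; have [] := branch_cut epc exy yB (negbT xB).
Qed.

(** * Counting connected sets *)

(** The forbidden set [A] serves to count inside a branch, where [A = [set p]],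
and to treat the children of a vertex one at a time. *)
Definition fam P A : {set {set U}} :=
  [set X | [&& conn X, P \subset X & [disjoint X & A]]].

(** The bijection sends [X] to its parts outside and inside the branch. *)
Lemma sum_fam_glue (F : nat -> nat) P A p c :
    e p c -> p \in P -> [disjoint P & branch p c] -> [disjoint A & branch p c] ->
  \sum_(X in fam (c |: P) A) F #|X| =
  \sum_(Y in fam P (c |: A)) \sum_(Q in fam [set c] [set p]) F (#|Y| + #|Q|).
Proof.
move=> epc pP PB AB; set B := branch p c in PB AB *.
have npc : p != c by apply: contraTneq epc => ->; rewrite e_irr.
rewrite pair_big /=.
rewrite (reindex_onto (fun YQ : {set U} * {set U} => YQ.1 :|: YQ.2)
   (fun X => (X :\: B, X :&: B))) /=; last by move=> X _; rewrite setUC setID.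
have F1B Y : Y \in fam P (c |: A) -> [disjoint Y & B].
  rewrite inE => /and3P[cY PY YA]; apply: conn_branch_disjoint => //.
    exact: subsetP PY p pP.
  by apply: contraL YA => cinY; apply/pred0Pn; exists c; rewrite /= cinY setU11.
have F2B Q : Q \in fam [set c] [set p] -> Q \subset B.
  rewrite inE sub1set disjoint_sym disjoints1 => /and3P[cQ cinQ pQ].
  exact: conn_branch_sub.
have split_eq (Y Q : {set U}) : [disjoint Y & B] -> Q \subset B ->
    ((Y :|: Q) :\: B = Y) * ((Y :|: Q) :&: B = Q).
  move=> YB QB; split.
    rewrite setDUl (setDidPl YB); move: QB; rewrite -setD_eq0 => /eqP->.
    by rewrite setU0.
  by rewrite setIUl (setIidPl QB); move: YB; rewrite -setI_eq0 => /eqP->; rewrite set0U.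
apply: eq_big => [[Y Q] /= | [Y Q] /= /andP[YQ /eqP[defY defQ]]]; last first.
  have YB : [disjoint Y & B].
    by rewrite -setI_eq0 -defY setDE -setIA [~: B :&: B]setIC setICr setI0.
  have QB : Q \subset B by rewrite -defQ subsetIr.
  by rewrite cardsU (disjoint_setI0 (disjointWr QB YB)) cards0 subn0.
apply/idP/idP=> [/andP[YQ /eqP[defY defQ]] | /andP[YF QF]].
  move: YQ; set X := Y :|: Q in defY defQ *.
  rewrite inE => /and3P[cX]; rewrite subUset sub1set => /andP[cinX PX] XA.
  have pX := subsetP PX p pP.
  rewrite -defY -defQ; apply/andP; split.
    rewrite inE conn_setD_branch //= subsetD PX PB /=.
    rewrite disjoint_setU1r inE branch_root /=.
    exact: disjointWl (subsetDl _ _) XA.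
  rewrite inE conn_setI_branch //= sub1set inE cinX branch_root /=.
  by rewrite disjoint_sym disjoints1 inE negb_and branch_notin // orbT.
have [-> ->] := split_eq Y Q (F1B _ YF) (F2B _ QF); rewrite eqxx andbT.
have QB := F2B _ QF.
move: YF QF; rewrite !inE => /and3P[cY PY YcA].
rewrite sub1set => /and3P[cQ cinQ _].
rewrite (connU cY cQ (subsetP PY p pP) cinQ epc) /=.
rewrite subUset sub1set inE cinQ orbT (subset_trans PY (subsetUl _ _)) /=.
move: YcA; rewrite disjoint_setU1r disjoint_setUl => /andP[_ ->] /=.
by rewrite disjoint_sym (disjointWr QB AB).
Qed.

Definition count P A : nat := #|fam P A|.
Definition total P A : nat := \sum_(X in fam P A) #|X|.
Definition mean P A : rat := ((total P A)%:R / (count P A)%:R)%R.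

Definition bcount p c := count [set c] [set p].
Definition btotal p c := total [set c] [set p].
(** The increase of the local mean when [c] is adjoined to a connected set that
contains [p]; see [mean_attach]. *)
Definition gain p c : rat :=
  ((btotal p c)%:R / ((bcount p c)%:R * (1 + (bcount p c)%:R)))%R.

Lemma fam_split (F : nat -> nat) P A c :
  \sum_(X in fam P A) F #|X| =
  \sum_(X in fam (c |: P) A) F #|X| + \sum_(X in fam P (c |: A)) F #|X|.
Proof.
rewrite (bigID (fun X => c \in X)) /=.
congr addn; apply: eq_bigl => X; rewrite !inE.
  by rewrite subUset sub1set; case: (c \in X); rewrite ?andbT ?andbF.
by rewrite disjoint_setU1r; case: (c \in X); rewrite ?andbT ?andbF.
Qed.

Lemma count_sum P A : count P A = \sum_(X in fam P A) 1.
Proof. by rewrite sum1_card. Qed.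

Lemma count_gt0 P A : conn P -> [disjoint P & A] -> 0 < count P A.
Proof. by move=> cP PA; apply/card_gt0P; exists P; rewrite inE cP subxx. Qed.

Lemma bcount_gt0 p c : e p c -> 0 < bcount p c.
Proof.
move=> epc; apply: count_gt0; first by apply: conn1; apply: e_V (p) _; rewrite e_sym.
by rewrite disjoints1 inE; apply: contraTneq epc => ->; rewrite e_irr.
Qed.

(** Only one of the connected sets counted has a single vertex. *)
Lemma btotal_ge p c : 2 * bcount p c <= btotal p c + 1.
Proof.
rewrite /bcount count_sum big_distrr /=.
rewrite (bigID (pred1 [set c])) /= /btotal /total [leqRHS]addnC.
rewrite [in leqRHS](bigID (pred1 [set c])) /= addnA; apply: leq_add; last first.
  apply: leq_sum => X /andP[]; rewrite inE sub1set => /and3P[_ cX _] Xc.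
  rewrite muln1 leqNgt; apply: contra Xc => X1.
  by rewrite eq_sym eqEcard sub1set cX cards1 -ltnS.
have [cF | cF] := boolP ([set c] \in fam [set c] [set p]); last first.
  by rewrite big1 // => X /andP[XF /eqP Xc]; rewrite Xc (negPf cF) in XF.
rewrite !(big_pred1 [set c]) ?cards1 // => X /=.
  by case: eqP => [->|_]; rewrite ?cF ?andbT ?andbF.
by case: eqP => [->|_]; rewrite ?cF ?andbT ?andbF.
Qed.

Lemma bcount_le_btotal p c : bcount p c <= btotal p c.
Proof.
rewrite /bcount count_sum; apply: leq_sum => X.
rewrite inE sub1set => /and3P[_ cX _]; apply/card_gt0P; by exists c.
Qed.

Section Attach.

Variables (P A : {set U}) (p c : U).
Hypotheses (epc : e p c) (pP : p \in P).
Hypotheses (PB : [disjoint P & branch p c]) (AB : [disjoint A & branch p c]).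

Lemma count_add : count (c |: P) A = count P (c |: A) * bcount p c.
Proof.
rewrite !count_sum (sum_fam_glue (fun=> 1) epc pP) // big_distrl /=.
by apply: eq_bigr => Y _; rewrite mul1n /bcount count_sum.
Qed.

Lemma total_add :
  total (c |: P) A = total P (c |: A) * bcount p c + count P (c |: A) * btotal p c.
Proof.
rewrite /total (sum_fam_glue id epc pP) // big_distrl /= count_sum big_distrl.
rewrite -big_split /=.
by apply: eq_bigr => Y _; rewrite big_split /= sum_nat_const mul1n mulnC.
Qed.

Lemma count_forbid : count P A = count P (c |: A) * (1 + bcount p c).
Proof.
rewrite !count_sum (fam_split (fun=> 1) P A c) -!count_sum count_add.
by rewrite mulnDr muln1 addnC.
Qed.

Lemma total_forbid : total P A =
  total P (c |: A) * (1 + bcount p c) + count P (c |: A) * btotal p c.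
Proof.
by rewrite /total (fam_split id P A c) -/(total _ _) total_add -/(total _ _); lia.
Qed.

Hypothesis N0 : 0 < count P (c |: A).
Local Open Scope ring_scope.

Lemma mean_forbid : mean P A = mean P (c |: A) + gain p c * (bcount p c)%:R.
Proof.
have b0 := bcount_gt0 epc.
rewrite /mean /gain total_forbid count_forbid !natrD !natrM !natrD.
field; rewrite -!(natrD _ 1) !pnatr_eq0 -!lt0n; lia.
Qed.

(** With [n] and [r] the count and the total at [c], both means exceed that of the
sets missing [c], by [r / n] and by [r / (1 + n)]. *)
Lemma mean_add : mean (c |: P) A = mean P A + gain p c.
Proof.
have b0 := bcount_gt0 epc.
rewrite mean_forbid /mean /gain total_add count_add !natrD !natrM.
field; rewrite -!(natrD _ 1) !pnatr_eq0 -!lt0n; lia.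
Qed.

End Attach.

Local Open Scope ring_scope.

Lemma gain_bound p c : e p c -> 1 <= gain p c * (1 + (bcount p c)%:R).
Proof.
move=> epc; have b0 : (1 : rat) <= (bcount p c)%:R by rewrite ler1n bcount_gt0.
have br : (bcount p c)%:R <= (btotal p c)%:R :> rat by rewrite ler_nat bcount_le_btotal.
rewrite /gain invfM mulrA mulfVK; last by lra.
by rewrite ler_pdivlMr ?mul1r //; lra.
Qed.

(** * Gains and children *)

Lemma gain_mean p c :
  e p c -> mean [set c] [set p] = gain p c * (1 + (count [set c] [set p])%:R).
Proof.
move=> epc; have b0 : (1 : rat) <= (bcount p c)%:R by rewrite ler1n bcount_gt0.
rewrite /gain invfM mulrA mulfVK // -/(bcount p c); lra.
Qed.

Lemma fam_nbrs v : v \in V -> fam [set v] (nbrs v) = [set [set v]].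
Proof.
move=> vV; apply/setP=> X; rewrite !inE sub1set.
apply/and3P/eqP=> [[cX vX Xn] | ->]; last first.
  by rewrite conn1 // set11 disjoints1 inE e_irr.
apply/eqP; rewrite eqEsubset sub1set vX andbT; apply/subsetP=> x xX.
apply: conn_closed cX _ vX xX (set11 v) => a b _ bX eab /set1P a_v.
by move/pred0P/(_ b): Xn; rewrite /= bX !inE -a_v eab.
Qed.

Lemma mean_nbrs v :
  v \in V -> (mean [set v] (nbrs v) = 1) * (count [set v] (nbrs v) = 1%N).
Proof.
by move=> vV; rewrite /mean /total /count fam_nbrs // big_set1 !cards1.
Qed.

(** The neighbours of [v] outside [A] are the children not yet forbidden;
forbidding them one after the other leaves [set v] as the only set. *)
Lemma child_recursion v A c : v \in V -> A \subset nbrs v -> c \in nbrs v :\: A ->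
  [/\ count [set v] A = (count [set v] (c |: A) * (1 + bcount v c))%N,
  mean [set v] A = mean [set v] (c |: A) + gain v c * (bcount v c)%:R &
  #|nbrs v :\: A| = #|nbrs v :\: (c |: A)|.+1].
Proof.
move=> vV An /setDP[cn cA]; have evc : e v c by rewrite inE in cn.
have dis (D : {set U}) : D \subset nbrs v -> [disjoint [set v] & D].
  by move=> Dn; rewrite disjoints1; apply/negP=> /(subsetP Dn); rewrite inE e_irr.
have cAn : c |: A \subset nbrs v by rewrite subUset sub1set cn.
have pos (D : {set U}) : D \subset nbrs v -> (0 < count [set v] D)%N.
  by move=> Dn; apply: count_gt0 (dis D Dn); apply: conn1.
have vB : [disjoint [set v] & branch v c].
  rewrite disjoints1 branch_notin //; by apply: contraTneq evc => <-; rewrite e_irr.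
have AB := nbrs_branch evc An cA.
split.
- exact: count_forbid evc (set11 v) vB AB.
- exact: mean_forbid evc (set11 v) vB AB (pos _ cAn).
by rewrite (cardsD1 c) inE cA cn /= add1n setDDl setUC.
Qed.

Lemma one_child v A : v \in V -> A \subset nbrs v -> #|nbrs v :\: A| = 1%N ->
  exists2 c, c \in nbrs v :\: A &
    mean [set v] A = 1 + gain v c * (bcount v c)%:R /\
    count [set v] A = (1 + bcount v c)%N.
Proof.
move=> vV An dA.
have [c cA] : exists c, c \in nbrs v :\: A by apply/card_gt0P; rewrite dA.
exists c => //; have [-> ->] := child_recursion vV An cA.
rewrite dA => -[] /esym/cards0_eq/eqP.
rewrite setD_eq0 => nA; case/setDP: cA => cn _.
have -> : c |: A = nbrs v by apply/eqP; rewrite eqEsubset subUset sub1set cn An.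
by rewrite !mean_nbrs // mul1n.
Qed.

(** For [A = [set p]] with [p] a neighbour of [v], the gain at [v] is [m / (1 + N)]
and the last two inequalities bound it; the other [A] serve the induction on the
number of children left, in which the first inequality is also needed. *)
Lemma many_children v A (g : rat) :
    v \in V -> A \subset nbrs v -> (2 <= #|nbrs v :\: A|)%N ->
    (forall c, c \in nbrs v :\: A -> gain v c <= g) ->
  let m := mean [set v] A in let N := (count [set v] A)%:R in
  [/\ 1 <= g ^+ 2 * N, m < g * (1 + N) &
      g <= 1 / 2 -> (1 + g ^+ 2) * m <= (3 - 2 * g) * g ^+ 2 * (1 + N)].
Proof.
move=> vV; move dA: #|nbrs v :\: A| => d.
elim: d => [//|d IHd] in A dA *; move=> An d2 gA /=.
have [c cA] : exists c, c \in nbrs v :\: A by apply/card_gt0P; rewrite dA.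
have [-> ->] := child_recursion vV An cA; rewrite dA => -[dcA].
have [cn cNA] := setDP cA; have evc : e v c by rewrite inE in cn.
have cAn : c |: A \subset nbrs v by rewrite subUset sub1set cn.
have sub c' : c' \in nbrs v :\: (c |: A) -> c' \in nbrs v :\: A.
  by rewrite !inE negb_or -andbA => /and3P[_ -> ->].
have b1 x : e v x -> 1 <= (bcount v x)%:R :> rat by move=> /bcount_gt0; rewrite ler1n.
have gb x : x \in nbrs v :\: A -> 1 <= g * (1 + (bcount v x)%:R).
  move=> xA; have evx : e v x by case/setDP: xA; rewrite inE.
  apply: le_trans (gain_bound evx) _; rewrite ler_wpM2r ?gA //.
  by have := b1 x evx; lra.
have g0 : 0 <= g.
  by have := gb c cA; have := b1 c evc; nra.
rewrite natrM natrD.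
have [d1 | dN1] := eqVneq d 1%N.
  have [x xA [-> ->]] := one_child vV cAn (etrans (esym dcA) d1).
  have evx : e v x by case/setDP: xA; rewrite inE.
  rewrite natrD; apply: two_children_estimate => //; try exact: b1; try exact: gb.
  - exact: gb (sub _ xA).
  - exact: gA.
  - exact: gA (sub _ xA).
apply: next_child_estimate => //; first exact: b1.
- rewrite ler1n; apply: count_gt0; first exact: conn1.
  by rewrite disjoints1; apply/negP=> /(subsetP cAn); rewrite inE e_irr.
- exact: gA.
apply: IHd => //; first by move: d2 dN1; clear; case: d => [|[]].
by move=> x /sub; apply: gA.
Qed.

(** The two conditions on gains are those that hold when neither exchange
increases the local mean. *)
Lemma no_exchange_stable_pair p v q w :
    e p v -> e q w -> (2 <= #|nbrs v|)%N -> (3 <= #|nbrs w|)%N ->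
    (forall x, e w x -> x != q -> gain w x <= gain p v) ->
    (forall y, e v y -> y != p -> gain v y <= gain q w) ->
  False.
Proof.
move=> epv eqw degv degw gw gv.
have V_of a b : e a b -> b \in V by rewrite e_sym; apply: e_V.
have [vV wV] := (V_of _ _ epv, V_of _ _ eqw).
have sub1 a b : e a b -> [set a] \subset nbrs b by rewrite sub1set inE e_sym.
have card1 a b : e a b -> #|nbrs b| = #|nbrs b :\: [set a]|.+1.
  by move=> eab; rewrite (cardsD1 a) inE e_sym eab.
have gainE a b (c : rat) : e a b ->
    mean [set b] [set a] < c * (1 + (count [set b] [set a])%:R) -> gain a b < c.
  move=> eab; rewrite gain_mean // ltr_pM2r //.
  by have := ler0n rat (count [set b] [set a]); lra.
rewrite (card1 q w) // ltnS in degw; rewrite (card1 p v) // ltnS in degv.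
have [] := many_children (g := gain p v) wV (sub1 _ _ eqw) degw.
  by move=> x; rewrite !inE => /andP[xq ewx]; apply: gw.
move=> _ /(gainE _ _ _ eqw) lt_wv le_wv.
have [deg2 | deg1] := ltnP 1 #|nbrs v :\: [set p]|.
  have [] := many_children (g := gain q w) vV (sub1 _ _ epv) deg2.
    by move=> x; rewrite !inE => /andP[xq ewx]; apply: gv.
  by move=> _ /(gainE _ _ _ epv) lt_vw _; have := lt_trans lt_wv lt_vw; rewrite ltxx.
have {degv}deg1 : #|nbrs v :\: [set p]| = 1%N by apply/eqP; rewrite eqn_leq deg1.
have [y] := one_child vV (sub1 _ _ epv) deg1.
rewrite !inE => /andP[yp evy] [mv cv].
have b0 : (1 : rat) <= (bcount v y)%:R by rewrite ler1n bcount_gt0.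
apply: (@single_child_absurd _ (gain p v) (gain v y)
  (bcount v y)%:R (btotal v y)%:R (gain q w)) => //.
- by have := btotal_ge v y; rewrite -(ler_nat rat) natrD natrM; lra.
- by rewrite !ler_nat; case: leqP.
- by rewrite /gain mulfVK // mulf_neq0 //; lra.
- rewrite -mv gain_mean // cv natrD addrA; congr (_ * (_ + _)); by ring.
- exact: gv.
move=> /le_wv; rewrite gain_mean // !mulrA ler_pM2r //.
by have := ler0n rat (count [set w] [set q]); lra.
Qed.

(** * Exchanging leaves *)

Lemma conn_rem_leaf X v p :
  conn X -> p \in X -> p != v -> {in X, forall x, e v x -> x = p} -> conn (X :\ v).
Proof.
move=> cX pX npv vp.
apply: (conn_retract (f := fun z => if z == v then p else z) cX).
- exact: subD1set.
- by move=> z zX; rewrite !inE; case: (eqVneq z v) => [_|->]; rewrite ?npv.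
- by move=> z /setD1P[/negPf->].
move=> x y xX yX; case: eqP => [->|_]; case: eqP => [->|_] exy; try by [left | right].
  by left; rewrite (vp y).
by left; rewrite (vp x) // e_sym.
Qed.

Lemma mean_attach P p c :
  conn P -> e p c -> p \in P -> c \notin P -> mean (c |: P) set0 = mean P set0 + gain p c.
Proof.
move=> cP epc pP cNP; apply: (mean_add epc pP).
- exact: conn_branch_disjoint.
- by rewrite -setI_eq0 set0I.
by apply: count_gt0 => //; rewrite disjoint_setU1r cNP -setI_eq0 setI0 /=.
Qed.

End ConnectedSets.

(** * Subtrees as connected vertex sets *)

Section Trees.

Variables (U : finType) (T : graph U).
Implicit Types (S H G : graph U) (X : {set U}) (x y v w : U).

Lemma adj_sym G : symmetric (adj G).
Proof. by move=> x y; rewrite /adj setUC. Qed.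

Lemma adj_irr G : simple_graph G -> irreflexive (adj G).
Proof.
move=> /forall_inP sG x; apply/negP => /sG.
by rewrite setUid cards1.
Qed.

Lemma adj_vertex G x y : simple_graph G -> adj G x y -> x \in vertices G.
Proof. by move=> /forall_inP sG /sG /andP[_ /subsetP]; apply; rewrite set21. Qed.

Lemma edgeP G a : simple_graph G -> a \in edges G ->
  exists x y, [/\ a = [set x; y], x != y & adj G x y].
Proof.
move=> /forall_inP sG aG; have /andP[/cards2P[x [y [nxy axy]]] _] := sG a aG.
by exists x, y; rewrite /adj -axy.
Qed.

Lemma deg_nbrs G v : simple_graph G -> deg G v = #|nbrs (adj G) v|.
Proof.
move=> sG; rewrite /deg.
have -> : [set a in edges G | v \in a] = [set [set v; y] | y in nbrs (adj G) v].
  apply/setP=> a; rewrite inE; apply/andP/imsetP=> [[aG va] | [y]]; last first.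
    by rewrite inE => vy ->; rewrite set21.
  have [x [y [axy _ xy]]] := edgeP sG aG; move: va; rewrite axy => /set2P[] ->.
    by exists y; rewrite // inE.
  by exists x; rewrite 1?setUC // inE adj_sym.
apply: card_in_imset => y z; rewrite !inE => vy vz eyz.
have nyv : y != v by apply: contraTneq vy => ->; rewrite adj_irr.
have : y \in [set v; z] by rewrite -eyz set22.
by rewrite !inE (negPf nyv) => /eqP.
Qed.

Hypothesis treeT : tree T.

Let simpleT : simple_graph T. Proof. by case: treeT. Qed.
Let T_sym := @adj_sym T.
Let T_irr := adj_irr simpleT.
Let T_vertex x y : adj T x y -> x \in vertices T := @adj_vertex T x y simpleT.
Let T_acyclic : forall c, ucycle (adj T) c -> size c <= 2.
Proof. by case: treeT. Qed.

Definition induced_graph X : graph U := (X, [set a in edges T | a \subset X]).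

Local Notation connT := (conn (adj T) (vertices T)).

Lemma adj_induced X x y : adj (induced_graph X) x y = induced (adj T) X x y.
Proof.
by rewrite /adj inE subUset !sub1set /= [RHS]andbA [RHS]andbC.
Qed.

Lemma subtree_induced_graph X : connT X -> X != set0 -> subtree (induced_graph X) T.
Proof.
move=> /connP[XV cX] X0; apply/and3P; split=> //; last first.
  apply/forall_inP=> x xX; apply/forall_inP=> y yX.
  by rewrite (eq_connect (adj_induced X)) cX.
apply/and3P; split=> //; last by apply/subsetP=> a; rewrite inE => /andP[].
apply/forall_inP=> a; rewrite inE => /andP[aT ->]; rewrite andbT.
by case/andP: (forall_inP simpleT a aT).
Qed.

Lemma subtree_conn H : subtree H T -> connT (vertices H).
Proof.
case/and3P=> /and3P[sH HV HE] _ /forall_inP cH; apply/connP; split=> // x y xH yH.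
move/forall_inP/(_ y yH): (cH x xH); apply: connect_sub => a b ab.
have ba : adj H b a by rewrite adj_sym.
apply: connect1; rewrite /= (adj_vertex sH ab) (adj_vertex sH ba).
by rewrite /adj (subsetP HE).
Qed.

(** An edge of [T] between two vertices of [H] that is not in [H] would close a
path of [H] to a cycle. *)
Lemma subtree_eq_induced H : subtree H T -> H = induced_graph (vertices H).
Proof.
case: H => X E; case/and3P=> /and3P[sH _ HE] _ cH; congr pair.
apply/setP=> a; rewrite inE; apply/idP/andP=> [aE | [aT aX]].
  by rewrite (subsetP HE) //; case/andP: (forall_inP sH a aE).
have [x [y [axy nxy xy]]] := edgeP simpleT aT.
have [xX yX] : x \in X /\ y \in X by apply/andP; rewrite -!sub1set -subUset -axy.
have /connectP[s0 path0 last0] := forall_inP (forall_inP cH x xX) y yX.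
case: (shortenP path0) last0 => s path_s uniq_s _ last_s.
have : ucycle (adj T) (x :: s).
  rewrite /ucycle /cycle rcons_path -last_s adj_sym xy uniq_s !andbT.
  by apply: sub_path path_s => b c bc; rewrite /adj (subsetP HE).
move/T_acyclic; case: s path_s last_s {uniq_s} => [_ xy'|z [|//]] /=.
  by rewrite xy' eqxx in nxy.
by rewrite andbT axy => + ->.
Qed.

Lemma subgraph_vertices S H :
  subtree S T -> subtree H T -> subgraph S H = (vertices S \subset vertices H).
Proof.
move=> sS sH; have /and3P[/and3P[simS _ _] _ _] := sS.
rewrite /subgraph simS /=; case: (boolP (vertices S \subset _)) => //= SH.
rewrite (subtree_eq_induced sS) (subtree_eq_induced sH).
apply/subsetP=> a; rewrite !inE => /andP[-> aS]; exact: subset_trans aS SH.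
Qed.

Lemma subtrees_containing_fam S : subtree S T ->
  subtrees_containing T S =
    [set induced_graph X | X in fam (adj T) (vertices T) (vertices S) set0].
Proof.
move=> sS; have /and3P[_ S0 _] := sS.
apply/setP=> H; rewrite inE; apply/andP/imsetP=> [[sH SH] | [X]].
  exists (vertices H); last exact: subtree_eq_induced.
  by rewrite inE subtree_conn // -subgraph_vertices // SH -setI_eq0 setI0 /=.
rewrite inE => /and3P[cX SX _] ->.
have sX : subtree (induced_graph X) T.
  apply: subtree_induced_graph => //; apply: contraNneq S0 => X0.
  by rewrite -subset0 -X0.
by rewrite subgraph_vertices.
Qed.

Lemma local_mean_fam S : subtree S T ->
  local_mean T S = mean (adj T) (vertices T) (vertices S) set0.
Proof.
move=> sS; rewrite /local_mean /num_subtrees /sum_of_orders subtrees_containing_fam //.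
have inj : injective induced_graph by move=> X Y [].
by rewrite card_imset // big_imset //=; apply: in2W.
Qed.

(** The subtree [S] with [v] replaced by [x] has order [k].  Both it and [S] arise
from [S] without [v] by adjoining one vertex, so the comparison of their local
means is a comparison of gains. *)
Lemma maximal_exchange k S v p w x :
    maximal_subtree T k S -> v \in vertices S -> w \in vertices S -> w != v ->
    nbrs (adj S) v = [set p] -> adj T w x -> x \notin vertices S ->
  (gain (adj T) (vertices T) w x <= gain (adj T) (vertices T) p v)%R.
Proof.
case=> sS kS maxS vS wS nwv Sv wx xS; have cS := subtree_conn sS.
have /and3P[/and3P[simS _ /subsetP ST] _ _] := sS.
have vp : adj S v p by have := set11 p; rewrite -Sv inE.
have pS : p \in vertices S by apply: (@adj_vertex S p v); rewrite // adj_sym.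
have npv : p != v by apply: contraTneq vp => ->; rewrite adj_irr.
set P := vertices S :\ v.
have cP : connT P.
  apply: (conn_rem_leaf T_sym cS pS npv) => y yS vy; apply/set1P; rewrite -Sv inE.
  by rewrite (subtree_eq_induced sS) adj_induced /= vS yS.
have xP : x \notin P by rewrite !inE negb_and xS orbT.
have wP : w \in P by rewrite !inE nwv.
have vP : v \notin P by rewrite !inE eqxx.
have cxP : connT (x |: P).
  rewrite setUC; apply: (connU T_sym cP _ wP (set11 x) wx).
  by apply: conn1; apply: T_vertex (w) _; rewrite adj_sym.
have xP0 : x |: P != set0 by apply/set0Pn; exists x; rewrite setU11.
have sxP := subtree_induced_graph cxP xP0.
have := maxS _ sxP; rewrite -kS /graph_order cardsU1 xP -(setD1K vS) cardsU1 vP.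
move=> /(_ erefl); rewrite !local_mean_fam //=.
rewrite -/P -(setD1K vS) -/P.
have pv : adj T p v by rewrite adj_sym; apply: ST.
have pP : p \in P by rewrite !inE npv.
have attach := mean_attach T_sym T_irr T_vertex T_acyclic cP.
by rewrite (attach _ _ pv pP vP) (attach _ _ wx wP xP) lerD2l.
Qed.

End Trees.

Theorem mainTheorem2 (U : finType) (T : graph U) (k : nat) (S : graph U) :
  tree T -> 0 < k -> k <= graph_order T -> maximal_subtree T k S ->
  forall w : U, leaf S w -> 2 < deg T w ->
  forall v : U, leaf S v -> v <> w -> deg T v = 1.
Proof.
move=> treeT _ _ maxS w /andP[wS degSw] degTw v /andP[vS degSv] /eqP nvw.
have [simT _ _ acT] := treeT; have [sS _ _] := maxS.
have /and3P[/and3P[simS _ /subsetP ST] _ _] := sS.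
rewrite deg_nbrs // in degSw; rewrite deg_nbrs // in degSv.
have /cards1P[q Sw] := degSw; have /cards1P[p Sv] := degSv.
have wq : adj S w q by have := set11 q; rewrite -Sw inE.
have vp : adj S v p by have := set11 p; rewrite -Sv inE.
have outside a b x : a \in vertices S -> nbrs (adj S) a = [set b] ->
    adj T a x -> x != b -> x \notin vertices S.
  move=> aS Sa ax; apply: contra => xS; rewrite -in_set1 -Sa inE.
  by rewrite (subtree_eq_induced treeT sS) adj_induced /= aS xS.
have Tdeg1 : 0 < deg T v.
  by rewrite deg_nbrs //; apply/card_gt0P; exists p; rewrite inE; apply: ST.
apply/eqP; rewrite eqn_leq Tdeg1 andbT leqNgt; apply/negP=> degTv.
rewrite deg_nbrs // in degTw; rewrite deg_nbrs // in degTv.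
have pv : adj T p v by rewrite adj_sym; apply: ST.
have qw : adj T q w by rewrite adj_sym; apply: ST.
have T_vertex x y : adj T x y -> x \in vertices T by apply: adj_vertex.
apply: (no_exchange_stable_pair (@adj_sym _ T) (adj_irr simT) T_vertex acT pv qw) => //.
- move=> x wx xq; apply: (maximal_exchange treeT maxS vS wS) => //.
    by rewrite eq_sym.
  exact: (outside w q).
- move=> y vy yp; apply: (maximal_exchange treeT maxS wS vS) => //.
  exact: (outside v p).
Qed.
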